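(* We have $\mathrm{RS}_0(1212)=\mathrm{RS}_1(1212)=1$, and for $n\ge 2$, $$\mathrm{RS}_n(1212)=2\,\mathrm{RS}_{n-1}(1212)+\sum_{k=1}^{n-2}q^k\,\mathrm{RS}_k(1212)\,\mathrm{RS}_{n-k-1}(1212).$$
   Context: A restricted growth function (RGF) of length $n$ is a sequence $w=w_1\dots w_n$ of positive integers with $w_1=1$ and $w_i\le 1+\max\{w_1,\dots,w_{i-1}\}$ for $i\ge 2$; $R_0$ consists of the empty word and $R_n$ is the set of RGFs of length $n$. The standardization of a word replaces every occurrence of its smallest letter by $1$, of its next smallest letter by $2$, and so on. An RGF $w$ contains an RGF $v$ if some subword (subsequence, not necessarily consecutive) of $w$ standardizes to $v$; otherwise $w$ avoids $v$. $R_n(v)$ is the set of $w\in R_n$ avoiding $v$. For a word $w$ and position $j$, $\mathrm{rs}(w_j)$ is the number of distinct values $w_i$ with $i>j$ and $w_i<w_j$, $\mathrm{rs}(w)=\sum_j\mathrm{rs}(w_j)$, and $\mathrm{RS}_n(v)=\sum_{w\in R_n(v)}q^{\mathrm{rs}(w)}$. *)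

(* Defs.v *)
From mathcomp Require Import all_boot all_order all_algebra.

Set Implicit Arguments.
Unset Strict Implicit.
Unset Printing Implicit Defensive.

Import GRing.Theory.

Local Open Scope nat_scope.

(* Words are [seq nat], indexed from 0. *)

Definition is_rgf (w : seq nat) : bool :=
  [&& all (fun x => 0 < x) w,
      (w == [::]) || (nth 0 w 0 == 1)
    & [forall i : 'I_(size w),
        (0 < i) ==> (nth 0 w i <= 1 + \max_(x <- take i w) x)]].

Definition standardize (w : seq nat) : seq nat :=
  [seq (index x (sort leq (undup w))).+1 | x <- w].

Definition contains (w v : seq nat) : bool :=
  [exists m : (size w).-tuple bool, standardize (mask m w) == v].

Definition avoids (w v : seq nat) : bool := ~~ contains w v.

Definition rs_at (w : seq nat) (j : nat) : nat :=
  size (undup [seq x <- drop j.+1 w | x < nth 0 w j]).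

Definition rs (w : seq nat) : nat := \sum_(j < size w) rs_at w j.

Definition word_of (n : nat) (t : n.-tuple 'I_n.+1) : seq nat :=
  [seq val x | x <- t].

(* The letters of an RGF of length n are at most n (see [Rgf_complete]), so
   restricting the alphabet to 'I_n.+1 loses nothing. *)
Definition Rgf (n : nat) : {set n.-tuple 'I_n.+1} :=
  [set t | is_rgf (word_of t)].

Definition Rgf_avoid (n : nat) (v : seq nat) : {set n.-tuple 'I_n.+1} :=
  [set t in Rgf n | avoids (word_of t) v].

(* The indeterminate q is 'X. *)
Definition RS (n : nat) (v : seq nat) : {poly int} :=
  (\sum_(t in Rgf_avoid n v) 'X^(rs (word_of t)))%R.

Lemma containsP (w v : seq nat) :
  reflect (exists2 s, subseq s w & standardize s = v) (contains w v).
Proof.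
apply: (iffP existsP) => [[m /eqP <-]|[s /subseqP[m szm ->] <-]].
  by exists (mask m w) => //; apply: mask_subseq.
by move/eqP: szm => szm; exists (Tuple szm).
Qed.

Lemma rgf_nth_le (w : seq nat) (i : nat) :
  is_rgf w -> i < size w -> nth 0 w i <= i.+1.
Proof.
case/and3P=> _ w0 /forallP wmax.
elim/ltn_ind: i => -[|i] IH lt_iw.
  by case/orP: w0 => [/eqP->|/eqP->].
have /= := wmax (Ordinal lt_iw); rewrite add1n => /leq_trans; apply.
rewrite ltnS; apply/bigmax_leqP_seq => x /(nthP 0)[j].
rewrite size_takel ?(ltnW lt_iw) // => lt_ji <- _.
by rewrite nth_take // (leq_trans (IH j lt_ji (ltn_trans lt_ji lt_iw))).
Qed.

Lemma Rgf_complete (w : seq nat) :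
  is_rgf w -> exists2 t, t \in Rgf (size w) & word_of t = w.
Proof.
move=> rw; have sz : size (map (@inord (size w)) w) == size w.
  by rewrite size_map.
suff wt : word_of (Tuple sz) = w by exists (Tuple sz); rewrite ?inE ?wt.
rewrite /word_of /= -map_comp -[RHS]map_id; apply/eq_in_map => x.
case/(nthP 0)=> i lt_iw <- /=; rewrite inordK // ltnS.
exact: leq_trans (rgf_nth_le rw lt_iw) lt_iw.
Qed.

Lemma word_of_inj (n : nat) : injective (@word_of n).
Proof. by move=> s t /(inj_map val_inj) /val_inj. Qed.

(* Main.v *)
Require Import Defs.
From mathcomp Require Import all_boot all_order all_algebra.
From mathcomp Require Import zify.
Import GRing.Theory.

Set Implicit Arguments.
Unset Strict Implicit.
Unset Printing Implicit Defensive.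

(** A nonempty RGF avoiding 1212 is uniquely [1 u' t], where [u'] contains no 1
    and [t] is empty or starts with 1.  Avoiding 1212 means that [t] and [u']
    have no common letter, so [u'] is an avoiding RGF [u] shifted by 1, and [t]
    is an avoiding RGF [v] whose letters above 1 are shifted by [max u].  When
    [t] is nonempty, each letter of [u'] sees exactly one smaller value in [t],
    namely 1, so [rs w = rs u + rs v + |u|]; when [t] is empty [rs w = rs u].
    The empty [u] and the empty [t] give the two terms [RS_{n-1}]. *)

Local Open Scope nat_scope.

(** * Order-preserving maps, and subsequences of a concatenation *)

Lemma mono_ltn_inj (f : nat -> nat) : {mono f : x y / x < y} -> injective f.
Proof.
by move=> fm x y fxy; have := fm x y; have := fm y x; rewrite fxy ltnn; lia.
Qed.

(** Letters are matched in order: once [y] can only land in [t], all of [p] lands there too. *)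
Lemma subseq_cat_notinl (T : eqType) (y : T) (p s t : seq T) :
  y \notin s -> subseq (y :: p) (s ++ t) -> subseq (y :: p) t.
Proof.
elim: s => //= z s IH; rewrite inE negb_or eq_sym => /andP[/negPf-> ys].
exact: IH.
Qed.

Lemma subseq_cat_notinr (T : eqType) (y : T) (p s t : seq T) :
  y \notin t -> subseq (rcons p y) (s ++ t) -> subseq (rcons p y) s.
Proof.
rewrite -subseq_rev -(subseq_rev _ s) rev_cat rev_rcons => yt.
by apply: subseq_cat_notinl; rewrite mem_rev.
Qed.

(** * Restricted growth relative to a running maximum *)

Fixpoint rgf_above (m : nat) (w : seq nat) : bool :=
  if w is x :: w' then (0 < x <= m.+1) && rgf_above (maxn m x) w' else true.

Lemma rgf_aboveP (m : nat) (w : seq nat) :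
  reflect (forall i, i < size w ->
             0 < nth 0 w i <= 1 + maxn m (\max_(x <- take i w) x))
          (rgf_above m w).
Proof.
elim: w m => [|x w IH] m /=; first by left.
apply: (iffP andP) => [[x_ok /IH w_ok] [|i] /= lt_i|w_ok].
- by rewrite big_nil maxn0.
- by rewrite big_cons maxnA; apply: w_ok.
split; first by have := w_ok 0 isT; rewrite /= big_nil maxn0.
by apply/IH => i lt_i; have := w_ok i.+1 lt_i; rewrite /= big_cons maxnA.
Qed.

(** Starting from maximum 0, the bound on the first letter is [0 < x <= 1], which forces it to be 1.
    Carrying the maximum as a parameter allows induction and splitting at a concatenation. *)
Lemma is_rgfE (w : seq nat) : is_rgf w = rgf_above 0 w.
Proof.
apply/idP/rgf_aboveP => [/and3P[/allP w_gt0 w0 /forallP w_le] i lt_i|w_ok].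
  rewrite w_gt0 ?mem_nth //= max0n.
  case: i lt_i => [|i] lt_i; last exact: (w_le (Ordinal lt_i)).
  by case/orP: w0 => [/eqP w0|/eqP->//]; rewrite w0 in lt_i.
apply/and3P; split.
- by apply/(all_nthP 0) => i /w_ok/andP[].
- case: w w_ok => // x w w_ok; have := w_ok 0 isT.
  by rewrite /= big_nil maxn0; case: x {w_ok} => [|[]].
- apply/forallP => i; apply/implyP => _.
  by have /andP[_] := w_ok i (ltn_ord i); rewrite max0n.
Qed.

Lemma rgf_above_cat (m : nat) (s t : seq nat) :
  rgf_above m (s ++ t) =
  rgf_above m s && rgf_above (maxn m (\max_(x <- s) x)) t.
Proof.
elim: s m => [|x s IH] m /=; first by rewrite big_nil maxn0.
by rewrite IH big_cons maxnA andbA.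
Qed.

Lemma rgf_above_gt0 (m : nat) (w : seq nat) :
  rgf_above m w -> {in w, forall x, 0 < x}.
Proof.
by move/rgf_aboveP=> w_ok x /(nthP 0)[i lt_i <-]; case/andP: (w_ok i lt_i).
Qed.

(** The running maximum grows by at most 1 at each letter, so no value between [m] and the final
    maximum is skipped. *)
Lemma rgf_above_mem (m : nat) (w : seq nat) (x : nat) :
  rgf_above m w -> m < x <= \max_(y <- w) y -> x \in w.
Proof.
elim: w m => [|y w IH] m /=; first by rewrite big_nil; lia.
case/andP=> y_ok /IH; rewrite big_cons inE => {}IH x_ok.
case: eqVneq => //= xy; apply: IH.
by move: xy x_ok y_ok; rewrite leq_max gtn_max; lia.
Qed.

Lemma rgf_above_map_succ (m : nat) (w : seq nat) :
  {in w, forall x, 0 < x} ->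
  rgf_above m.+1 (map succn w) = rgf_above m w.
Proof.
elim: w m => //= x w IH m w_gt0.
rewrite (w_gt0 x) ?mem_head // ltnS maxnSS IH // => y yw.
by apply: w_gt0; rewrite inE yw orbT.
Qed.

(** Fixing 0 as well makes [lift1 M] strictly increasing on all of [nat]. *)
Definition lift1 (M x : nat) : nat := if x <= 1 then x else x + M.

Lemma lift1_mono (M : nat) : {mono lift1 M : x y / x < y}.
Proof. by move=> x y; rewrite /lift1; case: ifP; case: ifP; lia. Qed.

(** Although [lift1] leaves the letter 1 in place, [0 < m] makes a 1 always admissible and without
    effect on the running maximum. *)
Lemma rgf_above_map_lift1 (M m : nat) (w : seq nat) :
  0 < m -> {in w, forall x, 0 < x} ->
  rgf_above (m + M) (map (lift1 M) w) = rgf_above m w.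
Proof.
elim: w m => //= x w IH m m_gt0 w_gt0.
have x_gt0 : 0 < x by apply: w_gt0; rewrite mem_head.
have -> : maxn (m + M) (lift1 M x) = maxn m x + M.
  by rewrite /lift1; case: ifP; lia.
rewrite IH; first 1 last.
- by rewrite leq_max m_gt0.
- by move=> y yw; apply: w_gt0; rewrite inE yw orbT.
  by congr (_ && _); rewrite /lift1; case: ifP; lia.
Qed.

Lemma max_map_succ (s : seq nat) :
  maxn 1 (\max_(x <- map succn s) x) = (\max_(x <- s) x).+1.
Proof.
elim: s => [|x s IH]; first by rewrite !big_nil.
by rewrite /= !big_cons maxnCA IH maxnSS.
Qed.

(** * Containment of 1212 *)

Lemma contains1212P (w : seq nat) :
  reflect (exists a b, a < b /\ subseq [:: a; b; a; b] w)
          (contains w [:: 1; 2; 1; 2]).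
Proof.
apply: (iffP (containsP _ _)) => [[s sw]|[a [b [lt_ab sw]]]].
  move: sw; case: s => [|a [|b [|c [|d []]]]] // sw.
  rewrite /standardize.
  set l := sort _ _ => /= -[ia ib ic id].
  have ml x : (x \in l) = (x \in [:: a; b; c; d]).
    by rewrite mem_sort mem_undup.
  have [la lb lc ld] : [/\ a \in l, b \in l, c \in l & d \in l].
    by rewrite !ml !inE !eqxx !orbT.
  have ac : a = c by rewrite -(nth_index 0 la) -(nth_index 0 lc) ia ic.
  have bd : b = d by rewrite -(nth_index 0 lb) -(nth_index 0 ld) ib id.
  exists a, b; split; last by rewrite {2}ac {2}bd.
  (* In the sorted list [l] of the letters used, [a] has index 0 and [b] has index 1. *)
  rewrite ltn_neqAle; apply/andP; split.
    by apply/eqP => ab; rewrite ab ib in ia.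
  have sl : sorted leq l by apply: sort_sorted; apply: leq_total.
  apply: (sorted_leq_index leq_trans leqnn sl) => //.
  by rewrite ia ib.
exists [:: a; b; a; b] => //; rewrite /standardize /= !inE !eqxx !orbT /=.
have /negPf ab : a != b by rewrite neq_ltn lt_ab.
have -> : sort leq (if a == b then [:: b] else [:: a; b]) = [:: a; b].
  by rewrite ab sorted_sort //= ?(ltnW lt_ab) //; apply: leq_trans.
by rewrite /= !eqxx ab.
Qed.

Lemma contains1212_map (f : nat -> nat) (w : seq nat) :
  {mono f : x y / x < y} ->
  contains (map f w) [:: 1; 2; 1; 2] = contains w [:: 1; 2; 1; 2].
Proof.
move=> fm; have finj := mono_ltn_inj fm.
apply/contains1212P/contains1212P => [[a [b [lt_ab]]]|[a [b [lt_ab sw]]]].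
  case/subseqP=> m; rewrite size_map => szm; rewrite -map_mask.
  have := mask_subseq m w.
  case: (mask m w) => [|c [|d [|c' [|d' []]]]] //= sw [ac bd ac' bd'].
  have cc' : c' = c by apply: finj; rewrite -ac.
  have dd' : d' = d by apply: finj; rewrite -bd.
  by exists c, d; split; [rewrite -fm -ac -bd | rewrite cc' dd' in sw].
exists (f a), (f b); rewrite fm; split=> //.
exact: (map_subseq f sw).
Qed.

Lemma contains_subseq (v w p : seq nat) :
  subseq v w -> contains v p -> contains w p.
Proof.
move=> vw /containsP[s sv sp]; apply/containsP.
by exists s => //; apply: subseq_trans sv vw.
Qed.

(** * The statistic [rs] under maps and concatenation *)

Lemma rs_cons (x : nat) (w : seq nat) :
  rs (x :: w) = size (undup [seq y <- w | y < x]) + rs w.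
Proof. by rewrite /rs big_ord_recl /rs_at /= drop0. Qed.

Lemma rs_map (f : nat -> nat) (w : seq nat) :
  {mono f : x y / x < y} -> rs (map f w) = rs w.
Proof.
move=> fm; elim: w => //= x w IH; rewrite !rs_cons IH filter_map.
rewrite undup_map_inj ?size_map; last exact: mono_ltn_inj.
by congr (size (undup _) + _); apply: eq_filter => y /=; rewrite fm.
Qed.

Lemma rs_one_cons (w : seq nat) : {in w, forall x, 0 < x} -> rs (1 :: w) = rs w.
Proof.
move=> w_gt0; rewrite rs_cons (eq_in_filter (a2 := pred0)) ?filter_pred0 //.
by move=> x /w_gt0; case: x.
Qed.

(** Each letter of [s] sees exactly one more smaller value once [t] is appended, namely [c]; this
    value is new because all letters of [s] exceed [c]. *)
Lemma rs_cat (c : nat) (s t : seq nat) :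
  c \in t ->
  {in s, forall x, c < x /\ {in t, forall y, (y < x) = (y == c)}} ->
  rs (s ++ t) = rs s + rs t + size s.
Proof.
move=> ct; elim: s => [|x s IH] s_ok; first by rewrite /= {2}/rs big_ord0 addn0.
have [lt_cx x_ok] := s_ok x (mem_head _ _).
rewrite /= !rs_cons IH; last by move=> y ys; apply: s_ok; rewrite inE ys orbT.
suff -> : size (undup [seq y <- s ++ t | y < x]) =
          (size (undup [seq y <- s | y < x])).+1 by lia.
rewrite -[RHS]/(size (c :: undup [seq y <- s | y < x])).
apply/perm_size/uniq_perm; rewrite ?undup_uniq //=.
  rewrite undup_uniq andbT mem_undup mem_filter; apply/negP => /andP[_ cs].
  by have [] := s_ok c; rewrite ?inE ?cs ?orbT ?ltnn.
move=> y; rewrite inE !mem_undup !mem_filter mem_cat.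
have [->|ync] := eqVneq y c; first by rewrite lt_cx ct orbT.
have [/x_ok->|_] /= := boolP (y \in t); last by rewrite orbF.
rewrite (negPf ync) /=; case: (boolP (y \in s)) => ys; rewrite ?andbF //.
Qed.

(** * Gluing two words: growth, avoidance, statistic, injectivity *)

Definition glue (u v : seq nat) : seq nat :=
  1 :: map succn u ++ map (lift1 (\max_(x <- u) x)) v.

Lemma size_glue (u v : seq nat) : size (glue u v) = (size u + size v).+1.
Proof. by rewrite /= size_cat !size_map. Qed.

Lemma is_rgf_gt0 (w : seq nat) : is_rgf w -> {in w, forall x, 0 < x}.
Proof. by rewrite is_rgfE; apply: rgf_above_gt0. Qed.

Lemma is_rgf_head (w : seq nat) : is_rgf w -> (w == [::]) || (head 0 w == 1).
Proof. by case/and3P. Qed.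

(** The hypotheses stay weaker than [is_rgf], so that the equation can also be read backwards to
    certify both pieces of a decomposed word. *)
Lemma is_rgf_glue (u v : seq nat) :
  {in u, forall x, 0 < x} -> {in v, forall x, 0 < x} ->
  (v == [::]) || (head 0 v == 1) ->
  is_rgf (glue u v) = is_rgf u && is_rgf v.
Proof.
move=> u_gt0 v_gt0 v1; rewrite !is_rgfE /= max0n rgf_above_cat.
rewrite rgf_above_map_succ // max_map_succ; congr (_ && _).
case: v v1 v_gt0 => //= x v /eqP-> v_gt0 /=.
(* After the leading 1, the shifted [u] and the first 1 of [v], the running maximum is [1 + max u]:
   the value 1 reached inside [v], raised by [max u]. *)
rewrite (maxn_idPl _) // -add1n rgf_above_map_lift1 //.
by move=> y yv; apply: v_gt0; rewrite inE yv orbT.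
Qed.

Lemma mem_map_lift1_gt (M x : nat) (v : seq nat) :
  {in v, forall y, 0 < y} -> x \in map (lift1 M) v -> x = 1 \/ M.+1 < x.
Proof.
move=> v_gt0 /mapP[y /v_gt0 y_gt0 ->].
by rewrite /lift1; case: ifP; lia.
Qed.

Lemma mem_map_succ_le (x : nat) (u : seq nat) :
  {in u, forall y, 0 < y} -> x \in map succn u ->
  1 < x <= (\max_(y <- u) y).+1.
Proof.
move=> u_gt0 /mapP[y yu ->]; rewrite !ltnS u_gt0 //=.
exact: (leq_bigmax_seq (F := id)).
Qed.

Lemma succn_mono : {mono succn : x y / x < y}.
Proof. by []. Qed.

(** The two blocks have disjoint alphabets: letters of [s] lie in 2..M+1, those of [t] are 1 or
    exceed M+1. The block containing [b] then captures the whole pattern. *)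
Lemma contains1212_glue (u v : seq nat) :
  is_rgf u -> is_rgf v ->
  contains (glue u v) [:: 1; 2; 1; 2] =
  contains u [:: 1; 2; 1; 2] || contains v [:: 1; 2; 1; 2].
Proof.
move=> ru rv; set M := \max_(x <- u) x.
rewrite -(contains1212_map u succn_mono) -(contains1212_map v (lift1_mono M)).
rewrite /glue -/M; set s := map succn u; set t := map (lift1 M) v.
have s_ok x : x \in s -> 1 < x <= M.+1.
  exact: (mem_map_succ_le (is_rgf_gt0 ru)).
have t_ok x : x \in t -> x = 1 \/ M.+1 < x.
  exact: (mem_map_lift1_gt (is_rgf_gt0 rv)).
have t1 : t = [::] \/ exists t', t = 1 :: t'.
  have := is_rgf_head rv; rewrite /t; case: (v) => [|x v'] /=; first by left.
  by move/eqP->; right; exists (map (lift1 M) v').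
apply/idP/orP => [|[]]; first 1 last.
- apply: contains_subseq; apply: subseq_trans (subseq_cons _ _).
  exact: prefix_subseq.
- apply: contains_subseq; apply: subseq_trans (subseq_cons _ _).
  exact: suffix_subseq.
case/contains1212P=> a [b [lt_ab]].
have a_neq_b : (a == b) = false by apply/negbTE; rewrite neq_ltn lt_ab.
case: (boolP (b \in s)) => bs; last first.
- move=> sw; right; apply/contains1212P; exists a, b; split=> //.
  have {sw} : (a == 1) && subseq [:: b; a; b] (s ++ t)
              || subseq [:: a; b; a; b] (s ++ t).
    by move: sw => /=; case: eqP => _ ->; rewrite ?orbT.
  (* If [a] is matched by the leading 1, the 1 that opens [t] can replace it. *)
  case/orP=> [/andP[/eqP a1] /(subseq_cat_notinl bs) bt|].
    case: t1 bt => [->|[t' ->]] //=; rewrite a1 eqxx.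
    by have -> : (b == 1) = false by rewrite -a1 eq_sym.
  (* If [a] were in [s], the remaining [b a b] in [t] would put [a] in both blocks. *)
  have [as_|as_] := boolP (a \in s); last exact: subseq_cat_notinl.
  move=> abab; have /(subseq_cat_notinl bs)bab: subseq [:: b; a; b] (s ++ t).
    by apply: subseq_trans abab; apply: subseq_cons.
  have /t_ok : a \in t by apply: (mem_subseq bab); rewrite !inE eqxx orbT.
  by have := s_ok _ as_; lia.
move=> sw; left; apply/contains1212P; exists a, b; split=> //.
have bt : b \notin t.
  by apply/negP => /t_ok; have := s_ok _ bs; lia.
have bab : subseq [:: b; a; b] (s ++ t).
  move: sw => /=; case: eqP => // _ abab.
  by apply: subseq_trans abab; apply: subseq_cons.
(* The last [b] must be matched in [s], hence so is everything before it; then [a] is in [s], so it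
   is not the leading 1. *)
have {}bab := @subseq_cat_notinr _ b [:: b; a] _ _ bt bab.
have as_ : a \in s by apply: (mem_subseq bab); rewrite !inE eqxx orbT.
have a1 : (a == 1) = false by have := s_ok _ as_; lia.
move: sw => /=; rewrite a1.
exact: (@subseq_cat_notinr _ b [:: a; b; a]).
Qed.

Lemma rs_glue (u v : seq nat) :
  is_rgf u -> is_rgf v ->
  rs (glue u v) = rs u + rs v + (if v is [::] then 0 else size u).
Proof.
move=> ru rv; rewrite /glue; set M := \max_(x <- u) x.
have s_ok x := @mem_map_succ_le x _ (is_rgf_gt0 ru).
have t_ok x := @mem_map_lift1_gt M x _ (is_rgf_gt0 rv).
rewrite rs_one_cons; last first.
  by move=> x; rewrite mem_cat => /orP[/s_ok|/t_ok]; lia.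
have := is_rgf_head rv; case: v rv t_ok => [|y v] rv t_ok /=.
  by rewrite cats0 (rs_map _ succn_mono) {3}/rs big_ord0 !addn0.
(* The only letter of the second block below a letter of the first is 1. *)
move/eqP=> y1; rewrite (@rs_cat 1).
- by rewrite (rs_map _ succn_mono) (rs_map (y :: v) (lift1_mono M)) size_map.
- by rewrite y1 mem_head.
- move=> x /s_ok x_ok; split; first by case/andP: x_ok.
  by move=> z /t_ok z_ok; rewrite -/M in x_ok; lia.
Qed.

(** The first 1 after the leading one marks the end of the block of [u]. If there is none, [index]
    returns the length, which is again [size u]. *)
Lemma glue_inj (u v u' v' : seq nat) :
  is_rgf u -> is_rgf v -> is_rgf u' -> is_rgf v' ->
  glue u v = glue u' v' -> (u, v) = (u', v').
Proof.
have index1 p r : is_rgf p -> is_rgf r ->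
    index 1 (behead (glue p r)) = size p.
  move=> rp /is_rgf_head; rewrite /= index_cat size_map.
  case: ifP => [/(mem_map_succ_le (is_rgf_gt0 rp)) //|_].
  by case: r => [|x r] /=; rewrite ?addn0 // => /eqP->; rewrite addn0.
move=> ru rv ru' rv' eq_w.
have szu : size u = size u' by rewrite -(index1 u v) // eq_w index1.
case: eq_w => /eqP; rewrite eqseq_cat ?size_map // => /andP[/eqP eq_u /eqP].
have {}eq_u : u = u' by apply: inj_map eq_u; apply: succn_inj.
rewrite -eq_u => /inj_map-> //.
exact: mono_ltn_inj (lift1_mono _).
Qed.

(** * Decomposition of the avoiding RGFs *)

Definition avoiding_rgf (w : seq nat) : bool :=
  is_rgf w && avoids w [:: 1; 2; 1; 2].

Lemma avoiding_rgf_glue (u v : seq nat) :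
  is_rgf u -> is_rgf v ->
  avoiding_rgf (glue u v) = avoiding_rgf u && avoiding_rgf v.
Proof.
move=> ru rv; rewrite /avoiding_rgf /avoids contains1212_glue // negb_or.
rewrite is_rgf_glue ?ru ?rv //; try exact: is_rgf_gt0.
exact: is_rgf_head.
Qed.

Lemma avoiding_rgf_unglue (w : seq nat) :
  avoiding_rgf w -> w != [::] ->
  exists u v, [/\ avoiding_rgf u, avoiding_rgf v & w = glue u v].
Proof.
case: w => // x w aw _; have x1 : x = 1.
  by case/andP: aw => /is_rgf_head /= /eqP.
rewrite {}x1 {x} in aw *.
(* Cut before the next 1; without one, [index] is [size w] and [t] is empty. *)
pose s := take (index 1 w) w; pose t := drop (index 1 w) w.
have w_gt0 : {in w, forall x, 0 < x}.
  case/andP: aw => /is_rgf_gt0 w_gt0 _ x xw.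
  by apply: w_gt0; rewrite inE xw orbT.
have wE : w = s ++ t by rewrite cat_take_drop.
have s_gt1 : {in s, forall x, 1 < x}.
  move=> x xs; have : 0 < x by apply: w_gt0; rewrite wE mem_cat xs.
  rewrite leq_eqVlt => /predU1P[x1|//].
  by rewrite -x1 in xs; have := index_ltn xs; rewrite ltnn.
pose u := map predn s; pose M := \max_(x <- u) x.
have sE : s = map succn u.
  rewrite -map_comp -[LHS]map_id; apply/eq_in_map => x /s_gt1 /=.
  by case: x.
have u_gt0 : {in u, forall x, 0 < x}.
  by move=> x /mapP[y /s_gt1 y_gt1 ->]; lia.
have t1 : (t == [::]) || (head 0 t == 1).
  have [lt_i|ge_i] := ltnP (index 1 w) (size w).
    by rewrite /t -nth0 nth_drop addn0 nth_index ?eqxx ?orbT // -index_mem.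
  by rewrite /t drop_oversize.
have rs1 : rgf_above 1 s.
  case/andP: aw; rewrite is_rgfE /= max0n wE rgf_above_cat.
  by case/andP.
(* A letter [x] of [t] with [1 < x <= M.+1] would already occur in [s], since an RGF skips no value.
   The leading 1, [x] in [s], the 1 opening [t] and [x] later in [t] would form 1212. *)
have t_ok : {in t, forall x, x = 1 \/ M.+1 < x}.
  move=> x xt; have x_gt0 : 0 < x by apply: w_gt0; rewrite wE mem_cat xt orbT.
  have [x1|x1] := eqVneq x 1; [by left | right].
  rewrite ltnNge; apply/negP => le_xM.
  have xs : x \in s.
    apply: rgf_above_mem rs1 _; have := max_map_succ u; rewrite -sE -/M; lia.
  case: (negP (proj2 (andP aw))); apply/contains1212P; exists 1, x.
  split; first by lia.
  rewrite wE /=.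
  have -> : t = 1 :: behead t.
    by case: (t) t1 xt => //= y t' /eqP-> _.
  rewrite -[[:: x; 1; x]]/([:: x] ++ [:: 1; x]) cat_subseq ?sub1seq //=.
  rewrite sub1seq; move: xt x1; case: (t) t1 => //= y t' /eqP->.
  by rewrite inE => /predU1P[->|].
(* This inverts [lift1 M] on [t]; by [t_ok] the subtraction never truncates. *)
pose v := [seq if x <= 1 then x else x - M | x <- t].
have tE : t = map (lift1 M) v.
  rewrite -map_comp -[LHS]map_id; apply/eq_in_map => x /t_ok /=.
  by rewrite /lift1; case: (leqP x 1); case: ifP; lia.
have gE : 1 :: w = glue u v by rewrite /glue -/M -sE -tE -wE.
have v_gt0 : {in v, forall x, 0 < x}.
  by move=> x /mapP[y /t_ok y_ok ->]; case: ifP; lia.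
have v1 : (v == [::]) || (head 0 v == 1).
  by rewrite /v; case: (t) t1 => //= y t' /eqP->.
have /andP[] : is_rgf u && is_rgf v.
  by rewrite -is_rgf_glue // -gE; case/andP: aw.
move=> ru rv; exists u, v.
by have := aw; rewrite gE avoiding_rgf_glue // => /andP[-> ->].
Qed.

(** Plain words replace tuples, whose type depends on [n], so that words of different lengths can be
    glued and compared. *)
Definition avoiding_words (n : nat) : seq (seq nat) :=
  [seq word_of t | t <- enum (Rgf_avoid n [:: 1; 2; 1; 2])].

Lemma avoiding_words_uniq (n : nat) : uniq (avoiding_words n).
Proof. by rewrite map_inj_uniq ?enum_uniq //; apply: word_of_inj. Qed.

Lemma mem_avoiding_words (n : nat) (w : seq nat) :
  (w \in avoiding_words n) = (size w == n) && avoiding_rgf w.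
Proof.
apply/mapP/andP => [[t]|[/eqP<- /andP[rw aw]]].
  by rewrite mem_enum !inE => at_ ->; rewrite size_map size_tuple.
have [t rt tw] := Rgf_complete rw.
by exists t; rewrite ?tw // mem_enum !inE tw rw.
Qed.

(** Both lists are duplicate-free, the right one by [glue_inj]; they have the same members by
    [avoiding_rgf_unglue] and [avoiding_rgf_glue]. *)
Lemma avoiding_words_recur (n : nat) :
  perm_eq (avoiding_words n.+1)
          [seq glue u v | u <- [seq u | k <- iota 0 n.+1, u <- avoiding_words k],
                          v <- avoiding_words (n - size u)].
Proof.
set s := [seq u | k <- _, u <- _].
have mem_s u : (u \in s) = (size u <= n) && avoiding_rgf u.
  apply/allpairsPdep/andP => [[k [u' []]]|[le_u au]].
    rewrite mem_iota mem_avoiding_words => le_k /andP[/eqP szu au'] ->.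
    by rewrite szu -ltnS.
  by exists (size u), u; rewrite mem_iota mem_avoiding_words eqxx.
apply: uniq_perm; first exact: avoiding_words_uniq.
  apply: allpairs_uniq_dep.
  - apply: allpairs_uniq_dep; first exact: iota_uniq.
      by move=> k _; apply: avoiding_words_uniq.
    move=> _ _ /allpairsPdep[k [u [_ uk ->]]] /allpairsPdep[k' [u' [_ uk' ->]]].
    move=> /= uu'; move: uk uk'; rewrite -uu' !mem_avoiding_words.
    by case/andP=> /eqP <- _ /andP[/eqP <- _].
  - by move=> u _; apply: avoiding_words_uniq.
  move=> _ _ /allpairsPdep[u [v [us vs ->]]] /allpairsPdep[u' [v' [us' vs' ->]]].
  move: us us' vs vs'; rewrite !mem_s !mem_avoiding_words.
  case/andP=> _ /andP[ru _] /andP[_ /andP[ru' _]].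
  case/andP=> _ /andP[rv _] /andP[_ /andP[rv' _]] /=.
  by move/(glue_inj ru rv ru' rv') => [-> ->].
move=> w; rewrite mem_avoiding_words.
apply/andP/allpairsPdep => [[/eqP szw aw]|[u [v []]]].
  have [|u [v [au av wE]]] := avoiding_rgf_unglue aw.
    by rewrite -size_eq0 szw.
  have szuv : size u + size v = n.
    by apply: succn_inj; rewrite -szw wE size_glue.
  by exists u, v; rewrite mem_s mem_avoiding_words au av -szuv leq_addr addKn eqxx.
rewrite mem_s mem_avoiding_words => /andP[le_u au] /andP[/eqP szv av] ->.
rewrite size_glue szv subnKC // avoiding_rgf_glue ?au ?av //.
  by case/andP: au.
by case/andP: av.
Qed.

(** * The recurrence for the generating function *)

Local Open Scope ring_scope.

Lemma RS_sum (n : nat) :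
  RS n [:: 1; 2; 1; 2]%N = \sum_(w <- avoiding_words n) 'X^(rs w).
Proof. by rewrite /RS big_map -big_enum. Qed.

Lemma RS_zero : RS 0 [:: 1; 2; 1; 2]%N = 1.
Proof.
have: perm_eq (avoiding_words 0) [:: [::]].
  apply: uniq_perm; rewrite ?avoiding_words_uniq // => w.
  rewrite mem_avoiding_words size_eq0 inE.
  case: eqP => //= ->; rewrite /avoiding_rgf is_rgfE /=.
  by apply/contains1212P => -[a [b []]].
rewrite RS_sum => /(perm_big _)->.
by rewrite big_seq1 /rs big_ord0.
Qed.

(** Here [k] is the length of [u]. The case [k = n] means that [v] is empty, and then the factor
    ['X^k] contributed by the 1 opening the second block is absent. *)
Lemma RS_succ (n : nat) :
  RS n.+1 [:: 1; 2; 1; 2]%N =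
  \sum_(0 <= k < n.+1)
     (if k == n then 1 else 'X^k)
     * RS k [:: 1; 2; 1; 2]%N * RS (n - k)%N [:: 1; 2; 1; 2]%N.
Proof.
rewrite RS_sum (perm_big _ (avoiding_words_recur n)).
rewrite big_allpairs_dep big_allpairs_dep /index_iota subn0.
apply: eq_big_seq => k; rewrite mem_iota => /= le_kn.
rewrite [RS k _]RS_sum mulr_sumr mulr_suml.
apply: eq_big_seq => u; rewrite mem_avoiding_words => /andP[/eqP szu /andP[ru _]].
rewrite RS_sum mulr_sumr szu.
apply: eq_big_seq => v; rewrite mem_avoiding_words => /andP[/eqP szv /andP[rv _]].
rewrite rs_glue // szu.
have -> : (k == n) = (v == [::]) by rewrite -size_eq0 szv; lia.
case: v {rv szv} => [|y v] /=; first by rewrite mul1r -exprD addn0.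
by rewrite -!exprD; congr ('X^_); lia.
Qed.

Theorem theorem5p4 :
  [/\ RS 0 [:: 1; 2; 1; 2]%N = 1,
      RS 1 [:: 1; 2; 1; 2]%N = 1
    & forall n : nat, (2 <= n)%N ->
        RS n [:: 1; 2; 1; 2]%N =
          2%:R * RS (n - 1)%N [:: 1; 2; 1; 2]%N
          + \sum_(1 <= k < (n - 2).+1)
              'X^k * RS k [:: 1; 2; 1; 2]%N
                   * RS (n - k - 1)%N [:: 1; 2; 1; 2]%N].
Proof.
split; first exact: RS_zero.
  by rewrite RS_succ big_nat1 eqxx subnn RS_zero !mul1r.
(* Splitting off the last term ([v] empty) and the first ([u] empty) leaves the two copies of the
   preceding polynomial and the inner sum. *)
case=> [|[|n]] // _; rewrite RS_succ big_nat_recr //= eqxx subnn RS_zero mulr1.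
rewrite big_nat_recl //= RS_zero subn0 !mul1r subn1 /= !subSS subn0.
rewrite [RHS]addrC mulrDl mul1r addrA; congr (_ + _).
rewrite addrC; congr (_ + _).
rewrite big_add1; apply: eq_big_nat => k /andP[_ lt_kn].
rewrite (_ : (k.+1 == n.+1) = false); last by lia.
by congr (_ * RS _ _); lia.
Qed.
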